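(* For the plurality voting rule, every algorithm that solves the $(\epsilon,\delta)$-winner determination problem has sample complexity $\Omega\!\left(\frac{1}{\epsilon^2}\log\frac{1}{\delta}\right)$.
   Context: An election consists of a set of $n$ voters and a set $\mathcal{C}$ of $m$ candidates; each vote is a complete linear order over $\mathcal{C}$. A voting rule maps each profile of votes to a single winner (ties, if any, are broken by some arbitrary but fixed tie-breaking rule). In the plurality rule, a candidate gets one point from each vote in which it is ranked first, and the candidate with the maximum total score wins. The margin of victory (MOV) of a profile is the smallest number $k$ of votes such that the winner can be changed by changing $k$ votes while keeping the other votes unchanged. The $(\epsilon,\delta)$-winner determination problem: given a voting rule and a set of $n$ votes over $m$ candidates whose margin of victory is at least $\epsilon n$, output the winner with probability at least $1-\delta$ (probability over the algorithm's internal randomness, for every such input). The algorithm may query the vote of any voter, each query revealing the full vote; the sample complexity is the number of votes queried. *)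

(* Defs.v *)
From mathcomp Require Import all_boot all_order all_algebra perm.
From mathcomp Require Import all_classical all_reals all_analysis.
Set Implicit Arguments.
Unset Strict Implicit.
Unset Printing Implicit Defensive.
Import Order.TTheory GRing.Theory Num.Theory.
Local Open Scope classical_set_scope.
Local Open Scope ring_scope.

(* A vote is a linear order on the candidates 'I_m, encoded by the permutation
   sending each candidate to its position; position 0 is the top of the vote. *)
Definition profile (n m : nat) : Type := {ffun 'I_n -> 'S_m}.

Definition voting_rule (n m : nat) : Type := profile n m -> 'I_m.

Definition plurality_score (n m : nat) (s : profile n m) (c : 'I_m) : nat :=
  #|[pred i : 'I_n | s i c == 0%N :> nat]|.

(* The rule may resolve ties in any fixed way, possibly depending on the whole
   profile. *)
Definition is_plurality (n m : nat) (r : voting_rule n m) : Prop :=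
  forall (s : profile n m) (c : 'I_m),
    (plurality_score s c <= plurality_score s (r s))%N.

Definition votes_changed (n m : nat) (s s' : profile n m) : nat :=
  #|[pred i : 'I_n | s i != s' i]|.

(* At most n votes can be changed, so the default value n of the minimum only
   matters for a profile whose winner cannot be changed at all; for plurality
   with n >= 1 and m >= 2 there is none. *)
Definition margin_of_victory (n m : nat) (r : voting_rule n m)
    (s : profile n m) : nat :=
  \big[Order.min/n]_(s' : {ffun 'I_n -> 'S_m} | r s' != r s) votes_changed s s'.

(* Deterministic adaptive algorithms: [Query i k] asks for the vote v of voter i
   and continues with [k v]. *)
Inductive query_tree (n m : nat) : Type :=
| Output of 'I_m
| Query of 'I_n & ('S_m -> query_tree n m).

Fixpoint output (n m : nat) (t : query_tree n m) (s : profile n m) : 'I_m :=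
  match t with
  | Output c => c
  | Query i k => output (k (s i)) s
  end.

Fixpoint queried (n m : nat) (t : query_tree n m) (s : profile n m) :
    {set 'I_n} :=
  match t with
  | Output _ => finset.set0
  | Query i k => (i |: queried (k (s i)) s)%SET
  end.

(* The internal randomness is a seed w in Om, drawn before the first query; it
   may encode any coins that are tossed along the way. *)
Record randomized_algorithm (d : measure_display) (Om : measurableType d)
    (n m : nat) : Type := RandomizedAlgorithm {
  tree_of_seed :> Om -> query_tree n m;
  measurable_output : forall (s : profile n m) (c : 'I_m),
    measurable [set w | output (tree_of_seed w) s = c] }.

Definition valid_input (R : realType) (n m : nat) (r : voting_rule n m)
    (eps : R) (s : profile n m) : Prop :=
  eps * n%:R <= (margin_of_victory r s)%:R.

Definition solves_winner_determination (R : realType) (d : measure_display)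
    (Om : measurableType d) (P : probability Om R) (n m : nat)
    (r : voting_rule n m) (eps delta : R)
    (A : randomized_algorithm Om n m) : Prop :=
  forall s : profile n m, valid_input r eps s ->
    ((1 - delta)%:E <= P [set w | output (A w) s = r s])%E.

(* Worst case over the valid inputs and over the internal randomness. A voter
   who is queried repeatedly counts once, so a lower bound on q also bounds the
   number of query steps. *)
Definition sample_complexity_at_most (R : realType) (d : measure_display)
    (Om : measurableType d) (n m : nat) (r : voting_rule n m) (eps : R)
    (A : randomized_algorithm Om n m) (q : nat) : Prop :=
  forall s : profile n m, valid_input r eps s ->
    forall w : Om, (#|queried (A w) s| <= q)%N.

(* Main.v *)
(* Let only two candidates ever be ranked first, and draw the votes independently,
   each being for candidate c with probability p = 1/2 + 2 eps.  By Chernoff, up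
   to probability exp(- eps^2 n / 4) candidate c wins with margin at least eps n,
   so the algorithm must tell the laws P_true and P_false apart.  After the
   answers of k distinct voters the cylinder S of compatible profiles satisfies
   P_true(S) P_false(S) = (p (1 - p))^k, whatever the answers.  Hence, by Le Cam's
   Bhattacharyya argument, q queries leave a total error of at least
   (4 p (1 - p))^q / 2 = (1 - 16 eps^2)^q / 2, and for this to be O(delta) one needs
   q = Omega(eps^-2 ln (1 / delta)). *)
Require Import Defs.
From mathcomp Require Import all_boot all_order all_algebra perm.
From mathcomp Require Import all_classical all_reals all_analysis.
From mathcomp Require Import measurable_realfun ring lra zify.
Import Order.TTheory GRing.Theory Num.Theory.
Local Open Scope ring_scope.

Set Implicit Arguments.
Unset Strict Implicit.
Unset Printing Implicit Defensive.

(** * Product laws on bit vectors and the masses of their cylinders *)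

Definition product_weight (R : realType) (n : nat) (f : bool -> R)
    (x : {ffun 'I_n -> bool}) : R :=
  \prod_i f (x i).

Definition cylinder (n : nat) (S : {set 'I_n}) (x0 x : {ffun 'I_n -> bool}) :
    bool :=
  [forall j in S, x j == x0 j].

(** A cylinder is a product set, so the sum of products is a product of sums, in which each free
    coordinate contributes [f true + f false = 1]. *)
Lemma product_weight_cylinder (R : realType) (n : nat) (f : bool -> R)
    (S : {set 'I_n}) (x0 : {ffun 'I_n -> bool}) :
  f true + f false = 1 ->
  \sum_(x | cylinder S x0 x) product_weight f x = \prod_(j in S) f (x0 j).
Proof.
move=> f1; rewrite /product_weight.
have -> : \sum_(x | cylinder S x0 x) \prod_i f (x i) =
    \sum_(x in family (fun i => [pred b | (i \in S) ==> (b == x0 i)]))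
      \prod_i f (x i).
  by apply: eq_bigl => x; apply/forallP/familyP => h i; apply: h.
rewrite -(bigA_distr_big_dep (fun i b => (i \in S) ==> (b == x0 i))
  (fun=> f)) [RHS]big_mkcond /=.
apply: eq_bigr => i _; case: (i \in S) => /=; first by rewrite big_pred1_eq.
by rewrite big_bool.
Qed.

Lemma sum_product_weight (R : realType) (n : nat) (f : bool -> R) :
  \sum_(x : {ffun 'I_n -> bool}) product_weight f x = (f true + f false) ^+ n.
Proof.
rewrite /product_weight -(bigA_distr_bigA (fun=> f)) /=.
by rewrite (eq_bigr _ (fun _ _ => big_bool _ _)) prodr_const card_ord.
Qed.

(** The effect of querying a fresh voter: one child cylinder per answer. As [i] is not in [S],
    overwriting [x0] at [i] leaves the earlier answers intact. *)
Lemma sum_cylinder_split (R : realType) (n : nat)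
    (F : {ffun 'I_n -> bool} -> R) (S : {set 'I_n})
    (x0 : {ffun 'I_n -> bool}) (i : 'I_n) : i \notin S ->
  \sum_(x | cylinder S x0 x) F x =
  \sum_(b : bool) \sum_(x | cylinder (i |: S)%SET
      [ffun j => if j == i then b else x0 j] x) F x.
Proof.
move=> iS; rewrite (partition_big (fun x : {ffun 'I_n -> bool} => x i) predT)//=.
apply: eq_bigr => b _; apply: eq_bigl => x.
apply/andP/forall_inP => [[/forall_inP xS /eqP xi] j | h].
  rewrite in_setU1 ffunE; case: (eqVneq j i) => [-> _|_ /= jS]; first by rewrite xi.
  exact: xS.
split; last by have := h i; rewrite setU11 ffunE eqxx; apply.
apply/forall_inP => j jS; have := h j; rewrite setU1r// ffunE.
by case: (eqVneq j i) => [ji|_]; [rewrite -ji jS in iS|apply].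
Qed.

(** The law of one vote when [c] is the favoured side; [product_weight (bias p c)] is the law
    P_c. *)
Definition bias (R : realType) (p : R) (c b : bool) : R :=
  if b == c then p else 1 - p.

Lemma bias_sum (R : realType) (p : R) c : bias p c true + bias p c false = 1.
Proof. by rewrite /bias; case: c => /=; lra. Qed.

Lemma product_bias_ge0 (R : realType) (n : nat) (p : R) (c : bool)
    (x : {ffun 'I_n -> bool}) :
  0 <= p <= 1 -> 0 <= product_weight (bias p c) x.
Proof.
by move=> /andP[p0 p1]; apply: prodr_ge0 => i _; rewrite /bias; case: ifP; lra.
Qed.

(** * The two-hypothesis error of a query tree *)

Lemma min_ge_sqrt_mul (R : realType) (a b h s : R) :
  0 <= a -> 0 <= b -> 0 <= s -> a * b = h ^+ 2 ->
  2 * s * h - s ^+ 2 * (a + b) <= Num.min a b.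
Proof.
move=> a0 b0 s0 abh.
wlog ab : a b a0 b0 abh / a <= b.
  move=> H; case: (leP a b) => [ab|/ltW ab].
    by have := H a b; rewrite min_l //; apply.
  by have := H b a b0 a0; rewrite min_l // (addrC b) mulrC; apply.
rewrite min_l//.
(* Expanding this square gives [a >= 2 * s * sqrt (a * b) - s ^+ 2 * b]; the remaining term
   [s ^+ 2 * a] is slack that makes the bound symmetric. *)
have H : 0 <= (Num.sqrt a - s * Num.sqrt b) ^+ 2 by rewrite sqr_ge0.
have ea : Num.sqrt a ^+ 2 = a by rewrite sqr_sqrtr.
have eb : Num.sqrt b ^+ 2 = b by rewrite sqr_sqrtr.
have hle : h <= Num.sqrt a * Num.sqrt b.
  by rewrite -sqrtrM// abh sqrtr_sqr ler_norm.
have : s * h <= s * (Num.sqrt a * Num.sqrt b) by rewrite ler_wpM2l.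
have : 0 <= s ^+ 2 * a by rewrite mulr_ge0// sqr_ge0.
move: H; rewrite sqrrB exprMn ea eb; nra.
Qed.

Definition profile_of (n m : nat) (vote : bool -> 'S_m)
    (x : {ffun 'I_n -> bool}) : profile n m :=
  [ffun i => vote (x i)].

(* Linearizing min(a, b) >= sqrt(a b)^2 / (a + b) with a free parameter s makes
   the bound additive over the leaves of the tree.  The inputs on which more than
   q voters are queried count as errors: the query bound of the theorem says
   nothing about invalid profiles. *)
Lemma query_tree_error (R : realType) (n m q : nat) (p g s : R)
    (vote : bool -> 'S_m) (cand : bool -> 'I_m) (t : query_tree n m)
    (S : {set 'I_n}) (x0 : {ffun 'I_n -> bool}) :
  0 <= p <= 1 -> 0 <= s -> 0 <= g -> 2 * g <= 1 -> g ^+ 2 = p * (1 - p) ->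
  cand true != cand false -> (#|S| <= q)%N ->
  2 * s * ((2 * g) ^+ q * 2^-1 ^+ #|S|)
  - s ^+ 2 * (\sum_(c : bool) \sum_(x | cylinder S x0 x)
                product_weight (bias p c) x) <=
  \sum_(c : bool) \sum_(x | cylinder S x0 x) product_weight (bias p c) x *
    ((output t (profile_of vote x) != cand c)
     || (q < #|S :|: queried t (profile_of vote x)|)%N)%:R.
Proof.
move=> p01 s0 g0 g1 gp cand12.
(* Covers every place where the induction stops: one hypothesis errs on the whole cylinder, so the
   error is at least the smaller of its two masses. *)
have leaf (bad : bool -> bool) (S' : {set 'I_n}) (x1 : {ffun 'I_n -> bool})
    (F : bool -> {ffun 'I_n -> bool} -> bool) :
    (#|S'| <= q)%N ->
    (forall c x, cylinder S' x1 x -> bad c -> F c x) ->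
    bad true || bad false ->
    2 * s * ((2 * g) ^+ q * 2^-1 ^+ #|S'|)
    - s ^+ 2 * (\sum_(c : bool) \sum_(x | cylinder S' x1 x)
                product_weight (bias p c) x) <=
    \sum_(c : bool) \sum_(x | cylinder S' x1 x) product_weight (bias p c) x *
      (F c x)%:R.
  move=> Sq badF bad12; rewrite !big_bool/=.
  set a := \sum_(x | _) _; set b := \sum_(x | _) _.
  have a0 : 0 <= a by apply: sumr_ge0 => x _; apply: product_bias_ge0.
  have b0 : 0 <= b by apply: sumr_ge0 => x _; apply: product_bias_ge0.
  have ab : a * b = (g ^+ #|S'|) ^+ 2.
    rewrite /a /b !product_weight_cylinder ?bias_sum// -big_split/=.
    rewrite (eq_bigr (fun=> g ^+ 2)) ?prodr_const -?exprM ?(mulnC 2%N)//.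
    by move=> j _; rewrite gp /bias; case: (x1 j) => //=; rewrite mulrC.
  apply: (@le_trans _ _ (Num.min a b)).
    apply: le_trans (min_ge_sqrt_mul a0 b0 s0 ab); rewrite lerD2r.
    apply: ler_wpM2l; first by rewrite mulr_ge0.
    (* Since [2 * g <= 1], the exponent of [2 * g] may be raised to [q]; the factor [2^-1 ^+ #|S'|]
       stays, because it is the part that is additive over the tree. *)
    have -> : g ^+ #|S'| = (2 * g) ^+ #|S'| * 2^-1 ^+ #|S'|.
      by rewrite -exprMn mulrAC mulfV ?mul1r.
    apply: ler_wpM2r; first by rewrite exprn_ge0.
    by apply: ler_wiXn2l => //; rewrite mulr_ge0.
  have part c : bad c -> \sum_(x | cylinder S' x1 x) product_weight (bias p c) x
      <= \sum_(x | cylinder S' x1 x) product_weight (bias p c) x * (F c x)%:R.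
    by move=> bc; apply: ler_sum => x hx; rewrite badF// mulr1.
  have nneg c : 0 <= \sum_(x | cylinder S' x1 x)
      product_weight (bias p c) x * (F c x)%:R.
    by apply: sumr_ge0 => x _; rewrite mulr_ge0// product_bias_ge0.
  case/orP: bad12 => /part; have := nneg true; have := nneg false.
    by rewrite -/a => ? ? ?; rewrite ge_min; apply/orP; left; lra.
  by rewrite -/b => ? ? ?; rewrite ge_min; apply/orP; right; lra.
elim: t S x0 => [d|i k IH] S x0 Sq /=.
  apply: (leaf (fun c => d != cand c)) => //.
    by move=> c x _ ->.
  rewrite -negb_and; apply: contra cand12 => /andP[/eqP<- /eqP<-//].
have fold x : profile_of vote x i = vote (x i) by rewrite ffunE.
(* A repeated query reveals nothing: the cylinder fixes the answer, and only that subtree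
   matters. *)
case: (boolP (i \in S)) => iS.
  have Si : (S :|: [set i])%SET = S.
    by apply/finset.setUidPl; rewrite finset.sub1set.
  have e c : \sum_(x | cylinder S x0 x) product_weight (bias p c) x *
      ((output (k (profile_of vote x i)) (profile_of vote x) != cand c)
       || (q < #|S :|: (i |: queried (k (profile_of vote x i))
                              (profile_of vote x))|)%N)%:R =
     \sum_(x | cylinder S x0 x) product_weight (bias p c) x *
      ((output (k (vote (x0 i))) (profile_of vote x) != cand c)
       || (q < #|S :|: queried (k (vote (x0 i))) (profile_of vote x)|)%N)%:R.
    apply: eq_bigr => x /forall_inP/(_ i iS)/eqP xi.
    by rewrite fold xi finset.setUA Si.
  by rewrite (eq_bigr _ (fun c _ => e c)); apply: IH.
have [Sq'|Sq'] := ltnP #|S| q; last first.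
  (* The budget is spent, and a fresh query exceeds it, so every input of the cylinder counts as an
     error under both laws. *)
  apply: (leaf xpredT) => // c x _ _; apply/orP; right.
  apply: (@leq_trans #|(i |: S)%SET|); first by rewrite cardsU1 iS.
  by apply: subset_leq_card; rewrite finset.setUA (finset.setUC S) finset.subsetUl.
rewrite 2!(eq_bigr _ (fun c _ => sum_cylinder_split _ _ iS)).
rewrite [X in _ - _ * X]exchange_big [leRHS]exchange_big /= mulr_sumr.
have card1 : #|(i |: S)%SET| = #|S|.+1 by rewrite cardsU1 iS.
(* The power of 1/2 halves with each new voter, so the main term is shared equally by the two
   children. *)
have -> : 2 * s * ((2 * g) ^+ q * 2^-1 ^+ #|S|) =
   \sum_(b : bool) 2 * s * ((2 * g) ^+ q * 2^-1 ^+ #|(i |: S)%SET|).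
  by rewrite card1 big_bool/= exprS; field.
rewrite -sumrB; apply: ler_sum => b _.
set x1 := [ffun _ => _].
have e c : \sum_(x | cylinder (i |: S)%SET x1 x) product_weight (bias p c) x *
      ((output (k (profile_of vote x i)) (profile_of vote x) != cand c)
       || (q < #|S :|: (i |: queried (k (profile_of vote x i))
                              (profile_of vote x))|)%N)%:R =
     \sum_(x | cylinder (i |: S)%SET x1 x) product_weight (bias p c) x *
      ((output (k (vote b)) (profile_of vote x) != cand c)
       || (q < #|(i |: S) :|: queried (k (vote b)) (profile_of vote x)|)%N)%:R.
  apply: eq_bigr => x /forall_inP/(_ i (finset.setU11 _ _))/eqP xi.
  by rewrite fold xi ffunE eqxx finset.setUCA finset.setUA.
by rewrite (eq_bigr _ (fun c _ => e c)); apply: IH; rewrite card1.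
Qed.

(** * Plurality scores and the margin of victory *)

Lemma plurality_score_change (n m : nat) (s s' : profile n m) (c : 'I_m) :
  (plurality_score s c <= plurality_score s' c + votes_changed s s')%N.
Proof.
rewrite /plurality_score /votes_changed -cardUI.
apply: leq_trans (leq_addr _ _); apply: subset_leq_card; apply/fintype.subsetP => i.
by rewrite !inE => sc; case: (eqVneq (s i) (s' i)) => [<-|]; rewrite ?sc ?orbT.
Qed.

Lemma plurality_scoreD (n m : nat) (s : profile n m) (a b : 'I_m) :
  a != b -> (plurality_score s a + plurality_score s b <= n)%N.
Proof.
move=> ab; rewrite /plurality_score -cardUI [X in (_ + X)%N]eq_card0 ?addn0.
  by rewrite -[leqRHS]card_ord max_card.
move=> i; rewrite !inE; apply: contraNF ab => /andP[/eqP sa /eqP sb].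
by rewrite -(inj_eq (@perm_inj _ (s i))) -val_eqE/= sa sb.
Qed.

Lemma majority_wins (n m : nat) (r : voting_rule n m) (s : profile n m)
    (c : 'I_m) :
  is_plurality r -> (n < 2 * plurality_score s c)%N -> r s = c.
Proof.
move=> rP h; apply/eqP/negPn/negP => rc.
have := plurality_scoreD s rc; have := rP s c; lia.
Qed.

(** If [c] has score t, any rival has at most n - t. One changed vote shrinks the lead by at most 2,
    so dethroning [c] takes at least t - n/2 >= eps n changes. *)
Lemma margin_of_victory_majority (R : realType) (n m : nat)
    (r : voting_rule n m) (s : profile n m) (c : 'I_m) (eps : R) :
  is_plurality r -> (0 < n)%N -> 0 < eps <= 1 ->
  (2^-1 + eps) * n%:R <= (plurality_score s c)%:R ->
  r s = c /\ valid_input r eps s.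
Proof.
move=> rP n0 /andP[e0 e1] hc.
have n0' : 0 < n%:R :> R by rewrite ltr0n.
have rs : r s = c.
  apply: majority_wins => //; rewrite -(ltr_nat R) natrM; nra.
split=> //; rewrite /valid_input /margin_of_victory rs.
apply: (big_ind (fun k : nat => eps * n%:R <= k%:R)).
(* The default value n of the minimum also satisfies the bound, because [eps <= 1]. *)
- nra.
- by move=> x y hx hy; rewrite minEle; case: ifP.
move=> s' rs'.
have h1 := plurality_score_change s s' c.
have h2 := plurality_score_change s' s (r s').
have h3 := rP s' c.
have h4 := plurality_scoreD s rs'.
have h5 : votes_changed s' s = votes_changed s s'.
  by apply: eq_card => i; rewrite !inE eq_sym.
have : (2 * plurality_score s c <= n + 2 * votes_changed s s')%N by lia.
by rewrite -(ler_nat R) natrD !natrM; lra.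
Qed.

(** * Averaging over seeds and a Chernoff bound *)

Lemma expR_le_quad (R : realType) (y : R) :
  y <= 2^-1 -> expR y <= 1 + y + 2 * y ^+ 2.
Proof.
move=> y2.
have h := expR_ge1Dx (- y).
have e : expR y * expR (- y) = 1 by rewrite -expRD subrr expR0.
have := expR_gt0 y => ey.
have : expR y * (1 - y) <= 1.
  by rewrite -[leRHS]e; apply: ler_wpM2l; [exact: ltW|exact: h].
(* The product equals 1 + y^2 (1 - 2 y). *)
have : 1 <= (1 + y + 2 * y ^+ 2) * (1 - y) by nra.
move=> a b; rewrite -(@ler_pM2r _ (1 - y)); [lra|lra].
Qed.

(** The averaging direction of Yao's principle: integrating a bound valid for each seed turns it
    into one on error probabilities. Asking for [P (E i) <= D] only where [a i > 0] lets inputs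
    without any guarantee be given weight 0. *)
Lemma weighted_events_bound (R : realType) (d : measure_display)
    (Om : measurableType d) (P : probability Om R) (I : finType)
    (a : I -> R) (E : I -> set Om) (L D : R) :
  0 <= D -> (forall i, 0 <= a i) -> (forall i, measurable (E i)) ->
  (forall w, L <= \sum_i a i * \1_(E i) w) ->
  (forall i, 0 < a i -> (P (E i) <= D%:E)%E) ->
  L <= (\sum_i a i) * D.
Proof.
move=> D0 a0 mE hL hP.
case: (leP 0 L) => [L0|/ltW/le_trans]; last first.
  by apply; rewrite mulr_ge0// sumr_ge0.
rewrite -lee_fin.
have mindic i : measurable_fun [set: Om]
    (fun w => (a i * \1_(E i) w)%:E : \bar R).
  apply/measurable_EFinP; apply: measurable_funM => //.
have -> : L%:E = (\int[P]_w L%:E)%E.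
  by rewrite integral_cst//= probability_setT mule1.
apply: (@le_trans _ _ (\int[P]_w \sum_i (a i * \1_(E i) w)%:E)%E).
  apply: ge0_le_integral => //; first exact: emeasurable_sum.
  by move=> w _; rewrite sumEFin lee_fin.
rewrite ge0_integral_sum//=; last first.
  by move=> i w _; rewrite lee_fin mulr_ge0.
rewrite mulr_suml -sumEFin; apply: lee_sum => i _.
under eq_integral do rewrite EFinM.
rewrite ge0_integralZl//=; last first.
- by rewrite lee_fin.
- by apply/measurable_EFinP/measurable_indic/mE.
rewrite integral_indic// setIT EFinM.
have := a0 i; rewrite le_eqVlt => /predU1P[<-|ai]; first by rewrite !mul0e.
by rewrite lee_wpmul2l// ?lee_fin ?(ltW ai)// hP.
Qed.

Definition majority (R : realType) (n : nat) (eps : R) (c : bool)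
    (x : {ffun 'I_n -> bool}) : bool :=
  (2^-1 + eps) * n%:R <= #|[pred i | x i == c]|%:R.

(** Chernoff with parameter [l = eps / 2]: the tilting factor exp(l ((1/2 + eps) n - votes for [c]))
    is at least 1 off the majority event, and its expectation factorizes over the voters. The bias 2
    eps exceeds the threshold eps, which makes the mean exponent per voter negative. *)
Lemma minority_tail (R : realType) (n : nat) (eps : R) (c : bool) :
  0 < eps <= 8^-1 ->
  \sum_(x : {ffun 'I_n -> bool} | ~~ majority eps c x)
    product_weight (bias (2^-1 + 2 * eps) c) x <=
  expR (- (eps ^+ 2 / 4 * n%:R)).
Proof.
move=> /andP[e0 e8]; set p := 2^-1 + 2 * eps; set l := eps / 2.
have p01 : 0 <= p <= 1 by apply/andP; split; rewrite /p; lra.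
pose f b := bias p c b * expR (l * (2^-1 + eps - (b == c)%:R)).
apply: (@le_trans _ _ (\sum_(x : {ffun 'I_n -> bool}) product_weight f x)).
  rewrite [leRHS](bigID (fun x => ~~ majority eps c x))/=.
  apply: ler_wpDr.
    apply: sumr_ge0 => x _; apply: prodr_ge0 => i _.
    rewrite mulr_ge0 ?expR_ge0// /bias; case: ifP => _; lra.
  apply: ler_sum => x; rewrite /majority -ltNge => /ltW hx.
  rewrite [leRHS]big_split/= -expR_sum ler_peMr ?product_bias_ge0//.
  rewrite -[leLHS]expR0 ler_expR -mulr_sumr mulr_ge0//; first by rewrite /l; lra.
  rewrite sumrB sumr_const card_ord subr_ge0 -[leRHS]mulr_natr.
  apply: le_trans _ hx; rewrite -natr_sum ler_nat -sum1_card [leqRHS]big_mkcond.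
  by apply: leq_sum => i _; rewrite inE; case: ifP.
rewrite sum_product_weight.
have -> : - (eps ^+ 2 / 4 * n%:R) = n%:R * (- (eps ^+ 2 / 4)).
  by rewrite mulrC mulrN.
rewrite expRM_natl; apply: lerXn2r.
- by rewrite nnegrE addr_ge0// mulr_ge0 ?expR_ge0// /bias; case: ifP => _; lra.
- by rewrite nnegrE expR_ge0.
(* It remains to bound one factor by 1 - eps^2/4. The linear terms yield -eps^2/2, and the quadratic
   ones cost at most eps^2/8. *)
apply: le_trans (expR_ge1Dx _).
have -> : f true + f false =
    p * expR (l * (eps - 2^-1)) + (1 - p) * expR (l * (eps + 2^-1)).
  have e1 : 2^-1 + eps - 1 = eps - 2^-1 by lra.
  have e2 : 2^-1 + eps - 0 = eps + 2^-1 by lra.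
  by rewrite /f /bias; case: c {f} => /=; rewrite e1 e2// addrC.
have h1 : expR (l * (eps - 2^-1)) <=
    1 + l * (eps - 2^-1) + 2 * (l * (eps - 2^-1)) ^+ 2.
  by apply: expR_le_quad; rewrite /l; nra.
have h2 : expR (l * (eps + 2^-1)) <=
    1 + l * (eps + 2^-1) + 2 * (l * (eps + 2^-1)) ^+ 2.
  by apply: expR_le_quad; rewrite /l; nra.
have /andP[p0 p1] := p01.
have g1 := ler_wpM2l p0 h1.
have g2 : (1 - p) * expR (l * (eps + 2^-1)) <=
    (1 - p) * (1 + l * (eps + 2^-1) + 2 * (l * (eps + 2^-1)) ^+ 2).
  by apply: ler_wpM2l => //; lra.
apply: le_trans (lerD g1 g2) _.
rewrite /p /l.
have -> : (2^-1 + 2 * eps) *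
      (1 + eps / 2 * (eps - 2^-1) + 2 * (eps / 2 * (eps - 2^-1)) ^+ 2) +
    (1 - (2^-1 + 2 * eps)) *
      (1 + eps / 2 * (eps + 2^-1) + 2 * (eps / 2 * (eps + 2^-1)) ^+ 2) =
    1 - eps ^+ 2 / 2 + eps ^+ 2 / 8 - 3 / 2 * eps ^+ 4.
  by field.
have : 0 <= eps ^+ 4 by apply: exprn_ge0; lra.
have : 0 <= eps ^+ 2 by apply: exprn_ge0; lra.
lra.
Qed.

(** * From elections to the two biased laws *)

Lemma two_top_votes (m : nat) : (2 <= m)%N ->
  exists (vote : bool -> 'S_m) (cand : bool -> 'I_m),
    cand true != cand false /\
    forall c d, (vote c d == 0%N :> nat) = (d == cand c).
Proof.
case: m => [|[|m]]// _.
pose cand (c : bool) : 'I_m.+2 := if c then ord0 else lift ord0 ord0.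
exists (fun c => tperm ord0 (cand c)), cand; split=> // c d.
by rewrite -[RHS](inj_eq (@perm_inj _ (tperm ord0 (cand c)))) tpermR.
Qed.

Lemma plurality_score_profile_of (n m : nat) (vote : bool -> 'S_m)
    (cand : bool -> 'I_m) (x : {ffun 'I_n -> bool}) (c : bool) :
  cand true != cand false ->
  (forall c d, (vote c d == 0%N :> nat) = (d == cand c)) ->
  plurality_score (profile_of vote x) (cand c) = #|[pred i | x i == c]|.
Proof.
move=> /negbTE cand12 top; apply: eq_card => i.
rewrite !inE ffunE top; case: (x i); case: c; rewrite ?eqxx//.
by rewrite eq_sym.
Qed.

Lemma error_probability_bound (R : realType) (n m q : nat) (eps delta : R)
    (r : voting_rule n m) (d : measure_display) (Om : measurableType d)
    (P : probability Om R) (A : randomized_algorithm Om n m) :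
  0 < eps <= 8^-1 -> 0 < delta -> (0 < n)%N -> (2 <= m)%N ->
  is_plurality r -> solves_winner_determination P r eps delta A ->
  sample_complexity_at_most r eps A q ->
  (1 - 16 * eps ^+ 2) ^+ q <=
  4 * expR (- (eps ^+ 2 / 4 * n%:R)) + 4 * delta.
Proof.
move=> eps8 delta0 n0 m2 rP hA hq.
have /andP[e0 e8] := eps8.
have [vote [cand [cand12 top]]] := two_top_votes m2.
set p := 2^-1 + 2 * eps; set T := expR _.
have p01 : 0 <= p <= 1 by apply/andP; split; rewrite /p; lra.
pose g := Num.sqrt (p * (1 - p)).
have pp0 : 0 <= p * (1 - p) by apply: mulr_ge0; lra.
have gp : g ^+ 2 = p * (1 - p) by rewrite sqr_sqrtr.
have g0 : 0 <= g by apply: sqrtr_ge0.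
have gsq : (2 * g) ^+ 2 = 1 - 16 * eps ^+ 2.
  by rewrite exprMn gp /p; field.
have g1 : 2 * g <= 1.
  rewrite -(@ler_pXn2r _ 2) ?nnegrE ?mulr_ge0// gsq expr1n.
  by rewrite gerBl mulr_ge0// sqr_ge0.
pose w c (x : {ffun 'I_n -> bool}) : R := product_weight (bias p c) x.
have w0 c (x : {ffun 'I_n -> bool}) : 0 <= w c x by apply: product_bias_ge0.
have w1 c : \sum_(x : {ffun 'I_n -> bool}) w c x = 1.
  by rewrite sum_product_weight bias_sum expr1n.
have win c (x : {ffun 'I_n -> bool}) : majority eps c x ->
    r (profile_of vote x) = cand c /\ valid_input r eps (profile_of vote x).
  move=> h; apply: margin_of_victory_majority => //; first by apply/andP; lra.
  by rewrite plurality_score_profile_of.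
(* The two laws have total mass 2, and this [s] maximizes 2 s (2 g)^q - 2 s^2; the maximum is 2 s^2
   = (1 - 16 eps^2)^q / 2. *)
pose s := (2 * g) ^+ q / 2.
have s0 : 0 <= s by rewrite divr_ge0// exprn_ge0// mulr_ge0.
(* Inputs without the majority may be invalid, where the algorithm promises nothing; they get weight
   0, at a cost of at most [T] per law. *)
pose a (cx : bool * {ffun 'I_n -> bool}) : R :=
  if majority eps cx.1 cx.2 then w cx.1 cx.2 else 0.
pose E (cx : bool * {ffun 'I_n -> bool}) : set Om :=
  (~` [set o | output (A o) (profile_of vote cx.2) = cand cx.1])%classic.
have a0 cx : 0 <= a cx by rewrite /a; case: ifP.
have mE cx : measurable (E cx) by apply: measurableC; apply: measurable_output.
have PE cx : 0 < a cx -> (P (E cx) <= delta%:E)%E.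
  rewrite /a; case: ifP; rewrite ?ltxx// => /win[rc vx] _.
  have := hA _ vx; rewrite rc /E probability_setC; last exact: measurable_output.
  rewrite -(@fineK _ (P _)) ?fin_num_measure//; last exact: measurable_output.
  by rewrite -EFinB !lee_fin; lra.
have sa : \sum_cx a cx <= 2.
  rewrite -(pair_bigA _ (fun c x => a (c, x))) big_bool/=.
  have h c : \sum_x a (c, x) <= 1.
    by rewrite -(w1 c); apply: ler_sum => x _; rewrite /a/=; case: ifP.
  by have := h true; have := h false; lra.
have pointwise o : 2 * s ^+ 2 - 2 * T <= \sum_cx a cx * \1_(E cx) o.
  have := query_tree_error vote (A o) [ffun=> true] p01 s0 g0 g1 gp cand12
    (leq_trans (eq_leq (cards0 _)) (leq0n q)).
  have cyl0 (F : {ffun 'I_n -> bool} -> R) :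
      \sum_(x | cylinder finset.set0 [ffun=> true] x) F x = \sum_x F x.
    by apply: eq_bigl => x; apply/forall_inP => j; rewrite inE.
  rewrite cards0 expr0 mulr1 !big_bool/= !cyl0.
  rewrite -/(w true) -/(w false) !w1.
  (* On majority inputs the budget [q] is respected, so only a wrong output can be an error;
     elsewhere the indicator is bounded by 1. *)
  have part c : \sum_x w c x *
      ((output (A o) (profile_of vote x) != cand c)
     || (q < #|finset.set0 :|: queried (A o) (profile_of vote x)|)%N)%:R <=
     \sum_x a (c, x) * \1_(E (c, x)) o + T.
    apply: le_trans (lerD (lexx _) (@minority_tail R n eps c eps8)).
    rewrite [X in _ + X]big_mkcond/= -big_split/=; apply: ler_sum => x _.
    rewrite /a/=; case: ifPn => [maj|_]; last first.
      by rewrite mul0r add0r ler_piMr//; case: (_ || _).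
    rewrite addr0 finset.set0U ltnNge hq ?orbF; last by have [] := win _ _ maj.
    rewrite indicE; case: eqVneq => [_|/eqP out]; first by rewrite mulr0 mulr_ge0.
    by rewrite mem_set.
  have -> : \sum_cx a cx * \1_(E cx) o =
      \sum_x a (true, x) * \1_(E (true, x)) o +
      \sum_x a (false, x) * \1_(E (false, x)) o.
    by rewrite -(pair_bigA _ (fun c x => a (c, x) * \1_(E (c, x)) o)) big_bool.
  have := part true; have := part false.
  have -> : (2 * g) ^+ q = 2 * s by rewrite /s; field.
  lra.
have := weighted_events_bound (ltW delta0) a0 mE pointwise PE.
have : (\sum_cx a cx) * delta <= 2 * delta by rewrite ler_wpM2r// ltW.
have -> : (1 - 16 * eps ^+ 2) ^+ q = 4 * s ^+ 2.
  by rewrite -gsq -exprM mulnC exprM /s; field.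
lra.
Qed.

(** * Solving the error bound for the number of queries *)

Lemma expRN2x_le (R : realType) (y : R) :
  0 <= y <= 2^-1 -> expR (- (2 * y)) <= 1 - y.
Proof.
move=> /andP[y0 y1]; have := expR_ge1Dx (2 * y); rewrite expRN => h.
apply: (@le_trans _ _ (1 + 2 * y)^-1).
  by rewrite lef_pV2 ?posrE ?expR_gt0//; lra.
(* Here (1 - y)(1 + 2 y) = 1 + y (1 - 2 y) >= 1. *)
by rewrite -[leLHS]div1r ler_pdivrMr; [nra|lra].
Qed.

Theorem theorem2 (R : realType) :
  exists c C eps0 delta0 : R,
    [/\ 0 < c, 0 < C, 0 < eps0 & 0 < delta0] /\
    forall (eps delta : R), 0 < eps < eps0 -> 0 < delta < delta0 ->
    forall n m : nat, (2 <= m)%N ->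
    C * (1 / eps ^+ 2 * ln (1 / delta)) <= n%:R ->
    forall r : voting_rule n m, is_plurality r ->
    forall (d : measure_display) (Om : measurableType d)
      (P : probability Om R) (A : randomized_algorithm Om n m),
    solves_winner_determination P r eps delta A ->
    forall q : nat, sample_complexity_at_most r eps A q ->
    c * (1 / eps ^+ 2 * ln (1 / delta)) <= q%:R.
Proof.
(* [C = 4] brings the Chernoff tail below delta, so the error bound becomes 4 delta + 4 delta.
   [eps0 = 1/8] gives 16 eps^2 <= 1/2, as [expRN2x_le] requires. [delta0 = 1/64] gives (8 delta)^2
   <= delta, and [c = 1/64] is read off the resulting exponent. *)
exists 64^-1, 4, 8^-1, 64^-1; split; first by split; lra.
move=> eps delta /andP[e0 e8] /andP[d0 d64] n m m2 hn r rP d Om P A hA q hq.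
set l := ln (1 / delta) in hn *.
have delta_exp : delta = expR (- l).
  by rewrite /l div1r lnV ?posrE// opprK lnK.
have l0 : 0 < l by rewrite /l ln_gt0// div1r invf_gt1//; lra.
have ee0 : 0 < eps ^+ 2 by apply: exprn_gt0.
have scale k : k * (1 / eps ^+ 2 * l) = k * l / eps ^+ 2.
  by field; rewrite gt_eqF.
rewrite scale ler_pdivrMr//; rewrite scale ler_pdivrMr// in hn.
have n0 : (0 < n)%N.
  rewrite lt0n; apply/eqP => n0; move: hn; rewrite n0 mul0r; lra.
have eps8 : 0 < eps <= 8^-1 by rewrite e0 ltW.
have := error_probability_bound eps8 d0 n0 m2 rP hA hq.
have tail : expR (- (eps ^+ 2 / 4 * n%:R)) <= delta.
  by rewrite delta_exp ler_expR; lra.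
have low : expR (- (32 * eps ^+ 2) * q%:R) <= (1 - 16 * eps ^+ 2) ^+ q.
  rewrite mulrC expRM_natl; apply: lerXn2r.
  - by rewrite nnegrE expR_ge0.
  - rewrite nnegrE; nra.
  have -> : 32 * eps ^+ 2 = 2 * (16 * eps ^+ 2) by ring.
  apply: expRN2x_le; apply/andP; split; nra.
move=> up.
have {low up} low : expR (- (32 * eps ^+ 2) * q%:R) <= 8 * delta by lra.
(* Squaring absorbs the constant 8, at the price of doubling the exponent. *)
have : expR (- (64 * eps ^+ 2 * q%:R)) <= expR (- l).
  have -> : - (64 * eps ^+ 2 * q%:R) =
      - (32 * eps ^+ 2) * q%:R + - (32 * eps ^+ 2) * q%:R by ring.
  rewrite expRD -delta_exp; have := expR_gt0 (- (32 * eps ^+ 2) * q%:R); nra.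
rewrite ler_expR; lra.
Qed.
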